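(* Let $A$ be the class of $(\text{claw},\text{co-claw})$-free graphs. For all integers $a,b\ge 3$, $$R_A(a,b)=\max\left\{\left\lfloor \frac{5a-3}{2}\right\rfloor,\left\lfloor \frac{5b-3}{2}\right\rfloor\right\},$$ unless $a=b=4$, in which case $R_A(a,b)=10$.
   Context: All graphs are finite, undirected, without loops or multiple edges. The claw is the star $K_{1,3}$; the co-claw is its complement, i.e. the disjoint union of a triangle and a single vertex. A graph is $(H_1,\dots,H_k)$-free if it contains none of $H_1,\dots,H_k$ as an induced subgraph. For a class $A$ of graphs, $R_A(a,b)$ is the minimum $n$ such that every graph in $A$ with at least $n$ vertices has either a clique of size $a$ or an independent set of size $b$. *)

(* Defs.v *)
From mathcomp Require Import all_boot.

Set Implicit Arguments.
Unset Strict Implicit.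
Unset Printing Implicit Defensive.

Record sgraph := SGraph {
  vertex :> finType;
  adj : rel vertex;
  adj_sym : symmetric adj;
  adj_irrefl : irreflexive adj
}.

Definition complement_rel (G : sgraph) : rel G :=
  fun x y => (x != y) && ~~ adj x y.

Lemma complement_sym (G : sgraph) : symmetric (@complement_rel G).
Proof. by move=> x y; rewrite /complement_rel eq_sym adj_sym. Qed.

Lemma complement_irrefl (G : sgraph) : irreflexive (@complement_rel G).
Proof. by move=> x; rewrite /complement_rel eqxx. Qed.

Definition complement (G : sgraph) : sgraph :=
  SGraph (@complement_sym G) (@complement_irrefl G).

Definition biclique_rel (m n : nat) : rel ('I_m + 'I_n)%type :=
  fun x y => match x, y with
             | inl _, inr _ | inr _, inl _ => true
             | _, _ => false
             end.

Lemma biclique_sym m n : symmetric (@biclique_rel m n).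
Proof. by move=> [x|x] [y|y]. Qed.

Lemma biclique_irrefl m n : irreflexive (@biclique_rel m n).
Proof. by move=> [x|x]. Qed.

Definition biclique (m n : nat) : sgraph :=
  SGraph (@biclique_sym m n) (@biclique_irrefl m n).

Definition claw : sgraph := biclique 1 3.
Definition coclaw : sgraph := complement claw.

Definition induced_subgraph (H G : sgraph) : Prop :=
  exists f : H -> G, injective f /\ forall x y : H, adj (f x) (f y) = adj x y.

Definition claw_coclaw_free (G : sgraph) : Prop :=
  ~ induced_subgraph claw G /\ ~ induced_subgraph coclaw G.

Definition clique (G : sgraph) (S : {set G}) : Prop :=
  {in S &, forall x y, x != y -> adj x y}.

Definition independent (G : sgraph) (S : {set G}) : Prop :=
  {in S &, forall x y, ~~ adj x y}.

Definition ramsey_bound (A : sgraph -> Prop) (a b n : nat) : Prop :=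
  forall G : sgraph, A G -> n <= #|G| ->
    (exists S : {set G}, #|S| = a /\ clique S) \/
    (exists S : {set G}, #|S| = b /\ independent S).

(* [is_ramsey_number A a b n] says that the minimum R_A(a,b) exists and
   equals [n]; for an arbitrary class it determines at most one [n]. *)
Definition is_ramsey_number (A : sgraph -> Prop) (a b n : nat) : Prop :=
  ramsey_bound A a b n /\ forall m, ramsey_bound A a b m -> n <= m.

(* Main.v *)
(** A (claw, co-claw)-free graph with at least 10 vertices cannot contain both
    a triangle and an independent triple: starting from such a configuration,
    an exhaustive search adding one vertex at a time never reaches 10 vertices.
    So in all relevant cases the graph or its complement is triangle-free and
    claw-free, hence has maximum degree at most 2 and an independent set on at
    least 2/5 of its vertices.  Extremal graphs are disjoint unions of 5-cycles
    (and possibly an edge), their complements, and, for a = b = 4, the line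
    graph of K_{3,3}. *)
Require Import Defs.
From mathcomp Require Import all_boot zify.

Set Implicit Arguments.
Unset Strict Implicit.
Unset Printing Implicit Defensive.

(** * Complementation, and claws in terms of vertices *)

Lemma induced_complement (H G : sgraph) :
  induced_subgraph H G -> induced_subgraph (complement H) (complement G).
Proof.
move=> [f [finj fadj]]; exists f; split=> // x y.
by rewrite /= /complement_rel (inj_eq finj) fadj.
Qed.

Lemma induced_complementK (H G : sgraph) :
  induced_subgraph (complement H) (complement G) -> induced_subgraph H G.
Proof.
move=> [f [finj fadj]]; exists f; split=> // x y.
have := fadj x y; rewrite /= /complement_rel (inj_eq finj).
by case: eqVneq => [-> _|_ /= /negb_inj //]; rewrite ?adj_irrefl.
Qed.

Lemma induced_claw_complement (G : sgraph) :
  induced_subgraph claw (complement G) <-> induced_subgraph coclaw G.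
Proof.
split=> [/induced_complement|] [f [finj fadj]].
  exists f; split=> // x y; rewrite -fadj /= /complement_rel.
  case: eqVneq => [->|ne] /=; first by rewrite !adj_irrefl.
  by rewrite /complement_rel ne negbK.
apply: induced_complementK; exists f; split=> // x y.
rewrite -[RHS]fadj /= /complement_rel.
case: eqVneq => [->|ne] /=; first by rewrite !adj_irrefl.
by rewrite /complement_rel ne negbK.
Qed.

Lemma claw_coclaw_free_complement (G : sgraph) :
  claw_coclaw_free G -> claw_coclaw_free (complement G).
Proof.
move=> [nclaw ncoclaw]; split; first by move/induced_claw_complement.
by move/induced_complementK.
Qed.

Lemma induced_clawP (G : sgraph) :
  induced_subgraph claw G <->
  exists c x y z : G, [/\ [&& x != y, x != z & y != z],
    [&& adj c x, adj c y & adj c z] & [&& ~~ adj x y, ~~ adj x z & ~~ adj y z]].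
Proof.
split=> [[f [finj fadj]]|[c [x [y [z [/and3P[xy xz yz] /and3P[cx cy cz]]]]]]].
  exists (f (inl ord0)), (f (inr ord0)), (f (inr (inord 1))), (f (inr (inord 2))).
  have ne (i j : 'I_3) : i != j :> nat -> f (inr i) != f (inr j).
    by move=> ij; apply: contra ij => /eqP/finj[->].
  by rewrite !fadj !ne ?inordK.
move=> /and3P[nxy nxz nyz].
have cN t : adj c t -> c != t by apply: contraTneq => <-; rewrite adj_irrefl.
have U : uniq [:: c; x; y; z] by rewrite /= !inE !negb_or !cN // xy xz yz.
have c_adj (j : 'I_3) : adj c (nth c [:: x; y; z] j).
  by case: j => [[|[|[|//]]] ?].
exists (fun i : claw => match i with
                        | inl _ => c | inr j => nth c [:: x; y; z] (nat_of_ord j) end).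
split=> [[i|i] [j|j] /eqP|[i|i] [j|j]]; rewrite /= ?adj_irrefl ?c_adj //.
- by rewrite (ord1 i) (ord1 j).
- by rewrite (negPf (cN _ (c_adj j))).
- by rewrite eq_sym (negPf (cN _ (c_adj i))).
- rewrite nth_uniq ?ltn_ord //; last by case/andP: U.
  by move=> /eqP/val_inj->.
- by rewrite adj_sym c_adj.
- case: i j => [[|[|[|//]]] ?] [[|[|[|//]]] ?] /=; rewrite ?adj_irrefl //;
  by apply: negbTE; rewrite // adj_sym.
Qed.

Lemma subset_of_card (T : finType) (A : {set T}) k :
  k <= #|A| -> exists2 B : {set T}, B \subset A & #|B| = k.
Proof.
move=> kA; exists [set x in take k (enum A)].
  by apply/subsetP=> x; rewrite inE => /mem_take; rewrite mem_enum.
rewrite cardsE (card_uniqP _) ?take_uniq ?enum_uniq // size_take -cardE.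
by case: ltnP => // Ak; apply/eqP; rewrite eqn_leq kA Ak.
Qed.

(** * Independent sets in triangle-free, claw-free graphs *)

Definition triangle_free (G : sgraph) :=
  forall x y z : G, adj x y -> adj x z -> ~~ adj y z.

Section TwoFifths.

Variable G : sgraph.
Hypothesis claw_free : ~ induced_subgraph claw G.
Hypothesis tri_free : triangle_free G.

Definition nbhd (S : {set G}) x := [set y in S | adj x y].
Definition outside (S : {set G}) x := S :\: (x |: nbhd S x).

(** Without triangles, three neighbours of [x] are pairwise nonadjacent and form a claw centred at
    [x]. *)
Lemma card_nbhd_le2 S x : #|nbhd S x| <= 2.
Proof.
rewrite leqNgt; apply/negP=> /card_geqP[s [us ss sN]]; apply: claw_free.
apply/induced_clawP; move: s us ss sN => [|y [|z [|t [|//]]]] //= us _ sN.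
have xN u : u \in [:: y; z; t] -> adj x u by move/sN; rewrite inE => /andP[].
have [xy xz xt] : [/\ adj x y, adj x z & adj x t].
  by split; apply: xN; rewrite !inE eqxx ?orbT.
exists x, y, z, t; split; last by rewrite !(tri_free (x := x)).
  by move: us; rewrite !inE negb_or andbT -andbA.
by rewrite xy xz.
Qed.

Lemma card_outside (S : {set G}) x :
  x \in S -> #|S| = #|outside S x| + #|nbhd S x|.+1.
Proof.
move=> xS; rewrite -(cardsID (x |: nbhd S x) S) addnC; congr (_ + _).
have /setIidPr -> : x |: nbhd S x \subset S.
  by rewrite subUset sub1set xS; apply/subsetP=> y; rewrite inE => /andP[].
by rewrite cardsU1 inE adj_irrefl andbF.
Qed.

Lemma independent_add (S : {set G}) x (I : {set G}) :
    x \in S -> I \subset outside S x -> independent I ->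
  [/\ x |: I \subset S, independent (x |: I) & #|x |: I| = #|I|.+1].
Proof.
move=> xS /subsetP IS indI.
have nadj y : y \in I -> ~~ adj x y.
  by move/IS; rewrite !inE negb_or => /andP[/andP[_ +] yS]; rewrite yS.
split.
- rewrite subUset sub1set xS; apply/subsetP=> y /IS; by rewrite inE => /andP[].
- move=> y z /setU1P[->|yI] /setU1P[->|zI]; rewrite ?adj_irrefl ?nadj //.
    by rewrite adj_sym nadj.
  exact: indI.
- rewrite cardsU1; case: (boolP (x \in I)) => // /IS.
  by rewrite !inE eqxx.
Qed.

(** Induction on [#|S|]. Taking a vertex of degree at most 1 costs at most 2 vertices. If all
    degrees are 2, two vertices with a common neighbour are taken: their closed neighbourhoods
    together cost at most 5 vertices. *)
Lemma two_fifths_independent (S : {set G}) :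
  exists I : {set G}, [/\ I \subset S, independent I & 2 * #|S| <= 5 * #|I|].
Proof.
have [n] := ubnP #|S|; elim: n S => // n IHn S ltSn.
have [->|[x0 x0S]] := set_0Vmem S.
  by exists set0; rewrite sub0set !cards0; split=> // x y; rewrite inE.
have [/existsP[x /andP[xS dx]]|/existsPn nodeg1] :=
    boolP [exists x, (x \in S) && (#|nbhd S x| <= 1)].
  have cS := card_outside xS.
  have [|I [IS indI cI]] := IHn (outside S x); first by lia.
  have [? ? cI'] := independent_add xS IS indI.
  exists (x |: I); split=> //; lia.
have deg2 x : x \in S -> #|nbhd S x| = 2.
  by move=> xS; move: (nodeg1 x) (card_nbhd_le2 S x); rewrite xS /=; lia.
set S1 := outside S x0.
have /eqP/cards2P[y [z [_ Nx0]]] := deg2 _ x0S.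
have [yS x0y] : y \in S /\ adj x0 y.
  by apply/andP; move: (set21 y z); rewrite -Nx0 inE.
have x0N : x0 \in nbhd S y by rewrite inE x0S adj_sym.
(* The second vertex [t] is the other neighbour of [y]; it is not adjacent to [x0], for [x0], [y],
   [t] would be a triangle. *)
have [t] : exists t, t \in nbhd S y :\ x0.
  by apply/card_gt0P; move: (cardsD1 x0 (nbhd S y)); rewrite deg2 // x0N; lia.
rewrite !inE => /and3P[tx0 tS yt].
have tS1 : t \in S1.
  rewrite !inE (negPf tx0) tS /= andbT.
  by apply: contraL yt => x0t; apply: (tri_free x0y).
(* The neighbour [y] of [t] has already left with [x0]. *)
have deg_t : #|nbhd S1 t| <= 1.
  have yN : y \in nbhd S t by rewrite inE yS adj_sym.
  have := cardsD1 y (nbhd S t); rewrite yN deg2 // => -[->].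
  apply/subset_leq_card/subsetP => u; rewrite !inE => /andP[/andP[+ uS] tu].
  rewrite uS tu !andbT; apply: contra => /eqP->; by rewrite x0y orbT.
have cS := card_outside x0S; have cS1 := card_outside tS1.
have [|I [IS indI cI]] := IHn (outside S1 t); first by rewrite -/S1 in cS; lia.
have [IS1 indI1 cI1] := independent_add tS1 IS indI.
have [? ? cI2] := independent_add x0S IS1 indI1.
exists (x0 |: (t |: I)); split=> //.
move: cS cS1 deg_t cI; rewrite deg2 // -/S1 cI2 cI1; clear; lia.
Qed.

End TwoFifths.

(** Rounding down still leaves [2 * #|G| >= 5 * b - 4], so [5 * #|I|] exceeds [5 * (b - 1)]. *)
Lemma triangle_free_independent (G : sgraph) b :
    ~ induced_subgraph claw G -> triangle_free G -> (5 * b - 3) %/ 2 <= #|G| ->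
  exists S : {set G}, #|S| = b /\ independent S.
Proof.
move=> nclaw ntri leG.
have [I [_ indI cI]] := two_fifths_independent nclaw ntri [set: G].
have [|B /subsetP BI cB] := @subset_of_card _ I b; first by rewrite cardsT in cI; lia.
by exists B; split=> // x y /BI xI /BI yI; apply: indI.
Qed.

(** * The exhaustive search on adjacency rows *)

(** The first four cases are claws centred at [x], [y], [z], [v]; the last four are co-claws with
    these as the isolated vertex. *)
Definition claw_or_coclaw (xy xz xv yz yv zv : bool) : bool :=
  [|| [&& xy, xz, xv, ~~ yz, ~~ yv & ~~ zv], [&& xy, yz, yv, ~~ xz, ~~ xv & ~~ zv],
      [&& xz, yz, zv, ~~ xy, ~~ xv & ~~ yv], [&& xv, yv, zv, ~~ xy, ~~ xz & ~~ yz],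
      [&& ~~ xy, ~~ xz, ~~ xv, yz, yv & zv], [&& ~~ xy, ~~ yz, ~~ yv, xz, xv & zv],
      [&& ~~ xz, ~~ yz, ~~ zv, xy, xv & yv] | [&& ~~ xv, ~~ yv, ~~ zv, xy, xz & yz]].

(** With [v] the new vertex, this loop fixes [v], [x], [y] and runs over the fourth vertex;
    [row_ok2] fixes [v], [x] and runs over [y]. *)
Fixpoint row_ok3 (vx vy xy : bool) (rx ry r : seq bool) : bool :=
  match rx, ry, r with
  | xz :: rx', yz :: ry', vz :: r' =>
      ~~ claw_or_coclaw xy xz vx yz vy vz && row_ok3 vx vy xy rx' ry' r'
  | _, _, _ => true
  end.

Fixpoint row_ok2 (vx : bool) (rx : seq bool) (rows : seq (seq bool)) (r : seq bool) :=
  match rx, rows, r with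
  | xy :: rx', ry :: rows', vy :: r' =>
      row_ok3 vx vy xy rx' ry r' && row_ok2 vx rx' rows' r'
  | _, _, _ => true
  end.

(* A graph on a list of vertices is encoded by its rows: each vertex carries its
   adjacencies to the vertices after it in the list.  [row_ok rows r] checks
   every 4-set made of a new head vertex with row [r] and 3 old vertices. *)
Fixpoint row_ok (rows : seq (seq bool)) (r : seq bool) : bool :=
  match rows, r with
  | rx :: rows', vx :: r' => row_ok2 vx rx rows' r' && row_ok rows' r'
  | _, _ => true
  end.

Fixpoint bitseqs n : seq (seq bool) :=
  if n is n'.+1 then
    [seq true :: r | r <- bitseqs n'] ++ [seq false :: r | r <- bitseqs n']
  else [:: [::]].

Lemma mem_bitseqs r : r \in bitseqs (size r).
Proof.
elim: r => //= b r IHr; rewrite mem_cat.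
by case: b; rewrite map_f ?orbT.
Qed.

(* Filtering, unlike [==>], prunes the search under call-by-value evaluation. *)
Fixpoint not_extendable n (rows : seq (seq bool)) : bool :=
  if n is n'.+1 then
    all (fun r => not_extendable n' (r :: rows))
        [seq r <- bitseqs (size rows) | row_ok rows r]
  else false.

Definition cotriangle := [:: [:: false; false]; [:: false]; [::]].

(** Rows of the triangle vertices [z], [y], [x] are put before an independent triple. The leading
    [true] bits are the triangle edges, the nine other bits are enumerated, and each row is tested
    before the next is chosen. No seventh vertex fits. *)
Lemma disjoint_search :
  all (fun rz => if row_ok cotriangle rz then
    all (fun ry => if row_ok (rz :: cotriangle) (true :: ry) then
      all (fun rx =>
          if row_ok [:: true :: ry, rz & cotriangle] [:: true, true & rx] then
            not_extendable 1 [:: [:: true, true & rx], true :: ry, rz & cotriangle]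
          else true)
        (bitseqs 3) else true) (bitseqs 3) else true) (bitseqs 3).
Proof. by vm_compute. Qed.

(** Here the triangle shares one vertex with the triple, the first one of [cotriangle]; four bits
    remain free, and five further vertices never fit. *)
Lemma meeting_search :
  all (fun rz => if row_ok cotriangle (true :: rz) then
    all (fun ry =>
        if row_ok ((true :: rz) :: cotriangle) [:: true, true & ry] then
          not_extendable 5 [:: [:: true, true & ry], true :: rz & cotriangle]
        else true)
      (bitseqs 2) else true) (bitseqs 2).
Proof. by vm_compute. Qed.

(** * From the search to bounds on the order of a graph *)

Section Search.

Variable G : sgraph.
Hypothesis G_free : claw_coclaw_free G.

Lemma no_claw_or_coclaw (x y z v : G) : uniq [:: v; x; y; z] ->
  ~~ claw_or_coclaw (adj x y) (adj x z) (adj v x) (adj y z) (adj v y) (adj v z).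
Proof.
have claw4 (H : sgraph) (c p q s : H) : ~ induced_subgraph claw H ->
    uniq [:: c; p; q; s] -> adj c p -> adj c q -> adj c s ->
    ~~ adj p q -> ~~ adj p s -> ~~ adj q s -> False.
  move=> nclaw U cp cq cs pq ps qs; apply/nclaw/induced_clawP.
  exists c, p, q, s; rewrite cp cq cs pq ps qs; split=> //.
  by move: U => /= /andP[_]; rewrite !inE negb_or andbT -andbA.
have [nclaw0 _] := G_free; have [nclaw _] := claw_coclaw_free_complement G_free.
move=> U.
have perm4 (s : seq G) : perm_eq s [:: v; x; y; z] -> uniq s by move/perm_uniq->.
have c0 (c p q s : G) := @claw4 G c p q s nclaw0.
have c1 (c p q s : G) := @claw4 (complement G) c p q s nclaw.
have perms c p q s : perm_eq [:: c; p; q; s] [:: v; x; y; z] ->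
   ~~ [&& adj c p, adj c q, adj c s, ~~ adj p q, ~~ adj p s & ~~ adj q s] /\
   ~~ [&& ~~ adj c p, ~~ adj c q, ~~ adj c s, adj p q, adj p s & adj q s].
  move=> /perm4 us; split; apply/negP=> /and5P[h1 h2 h3 h4 /andP[h5 h6]].
    exact: (c0 _ _ _ _ us).
  move: (us) => /=; rewrite !inE !negb_or !andbT.
  move=> /and3P[/and3P[n1 n2 n3] /andP[n4 n5] n6].
  by apply: (c1 _ _ _ _ us); rewrite /= /complement_rel ?n1 ?n2 ?n3 ?n4 ?n5 ?n6
    ?h1 ?h2 ?h3 ?h4 ?h5 ?h6.
(* These reorderings bring [x], [y] and [z] in turn to the head, where [perms] reads the centre. *)
have p1 := permEl (perm_catC [:: x; y; z] [:: v]).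
have p2 := perm_trans (permEl (perm_catCA [:: y] [:: x] [:: z; v])) p1.
have p3 := perm_trans (permEl (perm_catCA [:: z] [:: x; y] [:: v])) p1.
have [h1 h1'] := perms _ _ _ _ p1; have [h2 h2'] := perms _ _ _ _ p2.
have [h3 h3'] := perms _ _ _ _ p3.
have [h4 h4'] := perms _ _ _ _ (perm_refl [:: v; x; y; z]).
move: h1 h1' h2 h2' h3 h3' h4 h4'.
rewrite /claw_or_coclaw (adj_sym y x) (adj_sym z x) (adj_sym z y).
rewrite (adj_sym x v) (adj_sym y v) (adj_sym z v).
by case: (adj x y) (adj x z) (adj v x) (adj y z) (adj v y) (adj v z)
  => [] [] [] [] [] [].
Qed.

Fixpoint rows_of (s : seq G) : seq (seq bool) :=
  if s is v :: s' then map (adj v) s' :: rows_of s' else [::].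

Lemma size_rows_of s : size (rows_of s) = size s.
Proof. by elim: s => //= v s ->. Qed.

Lemma rows_of_ok v s : uniq (v :: s) -> row_ok (rows_of s) (map (adj v) s).
Proof.
have ok3 x y t : uniq [:: v, x, y & t] ->
    row_ok3 (adj v x) (adj v y) (adj x y)
            (map (adj x) t) (map (adj y) t) (map (adj v) t).
  elim: t => //= z t IHt U.
  have U1 : uniq [:: v, x, y & t].
    exact: subseq_uniq (cat_subseq (subseq_refl [:: v; x; y]) (subseq_cons t z)) U.
  have U2 : uniq [:: v; x; y; z].
    exact: subseq_uniq (cat_subseq (subseq_refl [:: v; x; y; z]) (sub0seq t)) U.
  by rewrite no_claw_or_coclaw //= IHt.
have ok2 x t : uniq [:: v, x & t] ->
    row_ok2 (adj v x) (map (adj x) t) (rows_of t) (map (adj v) t).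
  elim: t => //= y t IHt U; rewrite ok3 // IHt //.
  exact: subseq_uniq (cat_subseq (subseq_refl [:: v; x]) (subseq_cons t y)) U.
elim: s => //= x s IHs U; rewrite ok2 // IHs //.
exact: subseq_uniq (cat_subseq (subseq_refl [:: v]) (subseq_cons s x)) U.
Qed.

(** Unless [s] exhausts [G], a vertex outside [s] can be prepended. Its row passes the filter, so
    the search has covered it and the induction applies to the longer list. *)
Lemma not_extendable_card n s :
  uniq s -> not_extendable n (rows_of s) -> #|G| < size s + n.
Proof.
elim: n s => //= n IHn s us /allP stuck; rewrite addnS ltnS.
have [Gs|ltsG] := leqP #|G| (size s); first exact: leq_trans Gs (leq_addr _ _).
have [v vs] : exists v, v \notin s.
  apply/existsP; rewrite -negb_forall; apply: contraL ltsG => /forallP sT.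
  by rewrite -leqNgt -(card_uniqP us); apply/subset_leq_card/subsetP=> v _.
have U : uniq (v :: s) by rewrite /= vs.
have /stuck/(IHn _ U) : map (adj v) s \in
    [seq r <- bitseqs (size (rows_of s)) | row_ok (rows_of s) r].
  by rewrite mem_filter rows_of_ok // size_rows_of -(size_map (adj v)) mem_bitseqs.
by rewrite addSn.
Qed.

Arguments row_ok : simpl never.
Arguments not_extendable : simpl never.

Lemma disjoint_triangle_cotriangle_card (x y z u v w : G) :
    uniq [:: x; y; z; u; v; w] -> adj x y -> adj x z -> adj y z ->
    ~~ adj u v -> ~~ adj u w -> ~~ adj v w -> #|G| < 7.
Proof.
move=> U xy xz yz /negPf uv /negPf uw /negPf vw.
apply: (@not_extendable_card 1 [:: x; y; z; u; v; w]) => //.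
(* The actual rows pass each test of [disjoint_search], which is then instantiated at the actual
   adjacencies. *)
have okz : row_ok (rows_of [:: u; v; w]) (map (adj z) [:: u; v; w]).
  by apply/rows_of_ok/(subseq_uniq _ U)/(@suffix_subseq _ [:: x; y]).
have oky : row_ok (rows_of [:: z; u; v; w]) (map (adj y) [:: z; u; v; w]).
  by apply/rows_of_ok/(subseq_uniq _ U)/(@suffix_subseq _ [:: x]).
have := rows_of_ok U; move: oky okz.
rewrite /= xy xz yz uv uw vw -/cotriangle => oky okz okx.
have /allP/(_ _ (mem_bitseqs [:: adj z u; adj z v; adj z w])) := disjoint_search.
rewrite okz => /allP/(_ _ (mem_bitseqs [:: adj y u; adj y v; adj y w])).
rewrite oky => /allP/(_ _ (mem_bitseqs [:: adj x u; adj x v; adj x w])).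
by rewrite okx.
Qed.

(** The common vertex [x] stands third in the list, so that the tail [x], [u], [v] has rows
    [cotriangle]. *)
Lemma meeting_triangle_cotriangle_card (x y z u v : G) :
    uniq [:: y; z; x; u; v] -> adj x y -> adj x z -> adj y z ->
    ~~ adj x u -> ~~ adj x v -> ~~ adj u v -> #|G| < 10.
Proof.
move=> U xy xz yz /negPf xu /negPf xv /negPf uv.
apply: (@not_extendable_card 5 [:: y; z; x; u; v]) => //.
have okz : row_ok (rows_of [:: x; u; v]) (map (adj z) [:: x; u; v]).
  by apply/rows_of_ok/(subseq_uniq _ U)/(@suffix_subseq _ [:: y]).
have := rows_of_ok U; move: okz.
rewrite /= (adj_sym y x) (adj_sym z x) xy xz yz xu xv uv -/cotriangle => okz oky.
have /allP/(_ _ (mem_bitseqs [:: adj z u; adj z v])) := meeting_search.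
rewrite okz => /allP/(_ _ (mem_bitseqs [:: adj y u; adj y v])).
by rewrite oky.
Qed.

Lemma triangle_cotriangle_card (x y z u v w : G) :
    adj x y -> adj x z -> adj y z -> u != v -> u != w -> v != w ->
    ~~ adj u v -> ~~ adj u w -> ~~ adj v w -> #|G| < 10.
Proof.
have adjN (p q : G) : adj p q -> p != q.
  by apply: contraTneq => ->; rewrite adj_irrefl.
have meet (p q r s t : G) : adj p q -> adj p r -> adj q r -> p != s -> p != t ->
    s != t -> ~~ adj p s -> ~~ adj p t -> ~~ adj s t -> #|G| < 10.
  move=> pq pr qr ps pt st nps npt nst.
  apply: (@meeting_triangle_cotriangle_card p q r s t) => //.
  (* A neighbour of [p] differs from a non-neighbour, so triangle and triple share only [p]. *)
  have off c d : adj p c -> ~~ adj p d -> c != d by move=> pc; apply: contraNneq => <-.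
  rewrite /= !inE !negb_or !(eq_sym _ p) ps pt st.
  rewrite (adjN p q) // (adjN p r) // (adjN q r) //.
  by rewrite (off q s) // (off q t) // (off r s) // (off r t).
have on_triangle (p : G) q r : adj p q -> adj p r -> adj q r -> u != v -> u != w ->
    v != w -> ~~ adj u v -> ~~ adj u w -> ~~ adj v w -> p \in [:: u; v; w] -> #|G| < 10.
  move=> + + qr nuv nuw nvw auv auw avw.
  rewrite !inE => + + /or3P[] /eqP pE; rewrite {}pE => pq pr.
  - exact: (meet u q r v w).
  - by apply: (meet v q r u w); rewrite // 1?eq_sym // adj_sym.
  - by apply: (meet w q r u v); rewrite // 1?eq_sym // adj_sym.
move=> xy xz yz nuv nuw nvw auv auw avw.
have [xI|xI] := boolP (x \in [:: u; v; w]); first exact: (on_triangle x y z).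
have [yI|yI] := boolP (y \in [:: u; v; w]).
  by apply: (on_triangle y x z); rewrite // adj_sym.
have [zI|zI] := boolP (z \in [:: u; v; w]).
  by apply: (on_triangle z x y); rewrite // adj_sym.
apply: leq_trans (_ : 7 <= 10) => //.
apply: (@disjoint_triangle_cotriangle_card x y z u v w) => //.
rewrite (cat_uniq [:: x; y; z] [:: u; v; w]); apply/and3P; split.
- by rewrite /= !inE negb_or (adjN x y) // (adjN x z) // (adjN y z).
- by rewrite has_sym; apply/hasPn=> p; rewrite !(in_cons _ _ p) => /or4P[] // /eqP->.
- by rewrite /= !inE negb_or nuv nuw nvw.
Qed.

End Search.

(** * The upper bound *)

Lemma triangleP (G : sgraph) :
  triangle_free G \/ exists x y z : G, [/\ adj x y, adj x z & adj y z].
Proof.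
have [/existsP[x /existsP[y /existsP[z /and3P[]]]]|ntri] :=
  boolP [exists x : G, exists y, exists z, [&& adj x y, adj x z & adj y z]].
  by right; exists x, y, z.
left=> x y z xy xz; apply: contra ntri => yz.
by apply/existsP; exists x; apply/existsP; exists y; apply/existsP; exists z;
  apply/and3P.
Qed.

Lemma complement_independent_clique (G : sgraph) (S : {set G}) :
  @independent (complement G) S -> clique S.
Proof.
by move=> ind x y xS yS xy; have := ind x y xS yS; rewrite /= /complement_rel xy negbK.
Qed.

(** If [G] and its complement both contain triangles, then [#|G| < 10]. These triangles settle
    [a = 3] and [b = 3], and otherwise [10 <= n] is contradicted. *)
Lemma ramsey_upper (a b n : nat) : 3 <= a -> 3 <= b ->
    (5 * a - 3) %/ 2 <= n -> (5 * b - 3) %/ 2 <= n ->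
    (3 < a -> 3 < b -> 10 <= n) ->
  ramsey_bound claw_coclaw_free a b n.
Proof.
move=> a3 b3 na nb nab G G_free nG.
have [nclaw ncoclaw] := G_free.
have [ntri|[x [y [z [xy xz yz]]]]] := triangleP G.
  by right; apply: triangle_free_independent => //; apply: leq_trans nG.
have [ntri|[u [v [w []]]]] := triangleP (complement G).
  left; have [||S [cS /complement_independent_clique]] :=
    @triangle_free_independent (complement G) a _ ntri; last by exists S.
    by move/induced_claw_complement.
  exact: leq_trans nG.
rewrite /= /complement_rel => /andP[uv nuv] /andP[uw nuw] /andP[vw nvw].
have G10 : #|G| < 10 by apply: (@triangle_cotriangle_card G _ x y z u v w).
have adjN (p q : G) : adj p q -> p != q.
  by apply: contraTneq => ->; rewrite adj_irrefl.
have [a4|a_le3] := ltnP 3 a; last first.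
  left; exists [set x; y; z]; split.
    by rewrite -setUA cardsU1 cards2 !inE negb_or (adjN x y) // (adjN x z) //
      (adjN y z) //; apply/eqP; rewrite eqn_leq a3.
  move=> p q; rewrite !inE -!orbA => /or3P[] /eqP-> /or3P[] /eqP->;
  by rewrite ?eqxx // => _; rewrite // adj_sym.
have [b4|b_le3] := ltnP 3 b; last first.
  right; exists [set u; v; w]; split.
    by rewrite -setUA cardsU1 cards2 !inE negb_or uv uw vw;
      apply/eqP; rewrite eqn_leq b3.
  move=> p q; rewrite !inE -!orbA => /or3P[] /eqP-> /or3P[] /eqP->;
  by rewrite ?adj_irrefl // 1?adj_sym.
by have := leq_trans (nab a4 b4) nG; rewrite leqNgt G10.
Qed.

(** * Disjoint 5-cycles as extremal graphs *)

(** The quotient by 5 names the block, the remainder the place on its cycle. *)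
Definition pentagons_rel N : rel 'I_N := fun i j =>
  (i %/ 5 == j %/ 5) &&
  ((j %% 5 == (i %% 5).+1 %% 5) || (i %% 5 == (j %% 5).+1 %% 5)).

Lemma pentagons_sym N : symmetric (@pentagons_rel N).
Proof. by move=> i j; rewrite /pentagons_rel eq_sym orbC. Qed.

Lemma pentagons_irrefl N : irreflexive (@pentagons_rel N).
Proof. by move=> i; rewrite /pentagons_rel; lia. Qed.

(* The last block is a path when [N] is not a multiple of 5. *)
Definition pentagons N : sgraph := SGraph (@pentagons_sym N) (@pentagons_irrefl N).

Lemma pentagons_triangle_free N : triangle_free (pentagons N).
Proof. by move=> i j k; rewrite /= /pentagons_rel; lia. Qed.

(** Degrees are at most 2, and the leaves of a claw in the complement would be a triangle. *)
Lemma pentagons_free N : claw_coclaw_free (pentagons N).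
Proof.
split=> [/induced_clawP|/induced_claw_complement/induced_clawP].
  move=> [c [x [y [z [+ + _]]]]]; rewrite -!(inj_eq val_inj) /= /pentagons_rel; lia.
move=> [c [x [y [z [/and3P[xy xz yz] _]]]]].
rewrite /= /complement_rel xy xz yz !negbK => /and3P[axy axz].
by apply/negP; apply: (pentagons_triangle_free axy axz).
Qed.

(** The graph consists of pentagons, plus one edge when [b] is even. Two places per pentagon and one
    for the edge make [b - 1]; [g] maps [S] injectively to these places. *)
Lemma pentagons_independent b (S : {set pentagons ((5 * b - 5) %/ 2)}) :
  independent S -> 0 < b -> #|S| < b.
Proof.
move=> indS b0.
(* At most two elements of [S] lie in a pentagon: [second i] tells whether [i]
   is the larger of the two. *)
pose second (i : pentagons ((5 * b - 5) %/ 2)) :=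
  [exists j in S, (j < i) && (j %/ 5 == i %/ 5)].
pose g (i : pentagons ((5 * b - 5) %/ 2)) := 2 * (i %/ 5) + second i.
have nadj i j : i \in S -> j \in S -> i %/ 5 = j %/ 5 ->
    (j %% 5 != (i %% 5).+1 %% 5) && (i %% 5 != (j %% 5).+1 %% 5).
  by move=> iS jS ij; have := indS i j iS jS; rewrite /= /pentagons_rel ij eqxx negb_or.
(* Equal values with [i < j] make both [second], hence give three pairwise nonadjacent vertices
   [k < i < j] on one 5-cycle. *)
have not_lt i j : i \in S -> j \in S -> g i = g j -> ~~ (i < j).
  move=> iS jS gij; apply/negP=> ij.
  have bij : i %/ 5 = j %/ 5 by move: gij; rewrite /g; lia.
  have sj : second j by apply/existsP; exists i; rewrite iS ij bij eqxx.
  have /existsP[k /and3P[kS ki /eqP kbi]] : second i.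
    by move: gij; rewrite /g bij sj; lia.
  have := nadj _ _ iS jS bij; have := nadj _ _ kS iS kbi.
  by have := nadj _ _ kS jS (etrans kbi bij); clear - ij bij ki kbi; lia.
have g_inj : {in S &, injective g}.
  move=> i j iS jS gij; apply: val_inj; apply/eqP.
  by rewrite eqn_leq leqNgt not_lt //= leqNgt not_lt.
(* In a final block of two vertices no [i] is [second], since the two are adjacent. *)
have g_lt i : i \in S -> g i < b.-1.
  move=> iS; have ltiN := ltn_ord i; rewrite /g.
  case: (boolP (second i)) => [/existsP[j /and3P[jS ji /eqP bji]]|_].
    by have := nadj _ _ jS iS bji; clear - ji bji ltiN b0; lia.
  by clear - ltiN b0; lia.
suff leS : #|S| <= b.-1 by apply: leq_ltn_trans leS _; rewrite ltn_predL.
rewrite cardE -(size_map g) -(size_iota 0 b.-1).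
apply: uniq_leq_size.
  by rewrite map_inj_in_uniq ?enum_uniq // => i j; rewrite !mem_enum; apply: g_inj.
by move=> _ /mapP[i + ->]; rewrite mem_enum mem_iota; apply: g_lt.
Qed.

Lemma pentagons_clique N (S : {set pentagons N}) : clique S -> #|S| < 3.
Proof.
move=> cl; rewrite ltnNge; apply/negP=> /card_geqP[s [us ss sS]].
move: s us ss sS => [|x [|y [|z [|//]]]] //=; rewrite !inE negb_or andbT.
move=> /andP[/andP[xy xz] yz] _ sS.
have [xS yS zS] : [/\ x \in S, y \in S & z \in S].
  by split; apply: sS; rewrite !inE eqxx ?orbT.
have := pentagons_triangle_free (cl _ _ xS yS xy) (cl _ _ xS zS xz).
by rewrite cl.
Qed.

(** * The nine-vertex graph for [a = b = 4] *)

Definition rook_rel : rel ('I_3 * 'I_3) := fun p q =>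
  (p != q) && ((p.1 == q.1) || (p.2 == q.2)).

Lemma rook_sym : symmetric rook_rel.
Proof. by move=> p q; rewrite /rook_rel eq_sym (eq_sym p.1) (eq_sym p.2). Qed.

Lemma rook_irrefl : irreflexive rook_rel.
Proof. by move=> p; rewrite /rook_rel eqxx. Qed.

Definition rook : sgraph := SGraph rook_sym rook_irrefl.

(** Of three neighbours of [c], two agree with [c] under the same one of [f] and [g], hence are
    adjacent. *)
Lemma line_graph_claw_free (G : sgraph) (T1 T2 : eqType) (f : G -> T1) (g : G -> T2) :
    (forall x y : G, adj x y = (x != y) && ((f x == f y) || (g x == g y))) ->
  ~ induced_subgraph claw G.
Proof.
move=> adjE /induced_clawP[c [x [y [z [/and3P[xy xz yz]]]]]]; rewrite !adjE xy xz yz.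
move=> /and3P[/andP[_ /orP cx] /andP[_ /orP cy] /andP[_ /orP cz]].
by case: cx => /eqP ex; case: cy => /eqP ey; case: cz => /eqP ez;
  rewrite -?ex -?ey -?ez !eqxx ?orbT ?andbF.
Qed.

(* Mod 3, two cells in different rows and columns share a diagonal or an
   antidiagonal, so the rook graph is self-complementary. *)
Definition rook_diagonal (p : 'I_3 * 'I_3) : 'I_3 := inord ((p.1 + p.2) %% 3).
Definition rook_antidiagonal (p : 'I_3 * 'I_3) : 'I_3 := inord ((p.1 + 2 * p.2) %% 3).

Lemma rook_complementE (p q : complement rook) :
  adj p q = (p != q) && ((rook_diagonal p == rook_diagonal q) ||
                         (rook_antidiagonal p == rook_antidiagonal q)).
Proof.
case: p q => [p p'] [q q'].
rewrite /= /complement_rel /= /rook_rel /rook_diagonal /rook_antidiagonal.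
rewrite -!val_eqE /= !inordK ?ltn_pmod // !xpair_eqE -!val_eqE /=.
by case: p => [[|[|[|//]]] ?]; case: p' => [[|[|[|//]]] ?];
   case: q => [[|[|[|//]]] ?]; case: q' => [[|[|[|//]]] ?].
Qed.

Lemma rook_free : claw_coclaw_free rook.
Proof.
split; first exact: (@line_graph_claw_free rook _ _ fst snd).
by move/induced_claw_complement; apply: line_graph_claw_free rook_complementE.
Qed.

Lemma card_le_inj_ord (T : finType) (S : {set T}) n (f : T -> 'I_n) :
  {in S &, injective f} -> #|S| <= n.
Proof. by move=> /card_in_imset <-; rewrite -[leqRHS]card_ord max_card. Qed.

Lemma rook_independent (S : {set rook}) : independent S -> #|S| < 4.
Proof.
move=> indS; apply: (@card_le_inj_ord _ S 3 (fun p : rook => p.1)) => p q pS qS pq.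
have := indS p q pS qS; rewrite /= /rook_rel pq eqxx /= andbT negbK.
by move/eqP.
Qed.

(** Distinct cells on one diagonal are nonadjacent, so [rook_diagonal] is injective on a clique. *)
Lemma rook_clique (S : {set rook}) : clique S -> #|S| < 4.
Proof.
move=> clS; apply: (@card_le_inj_ord _ S 3 rook_diagonal) => p q pS qS pq.
apply/eqP/idPn => ne; have := rook_complementE p q.
by rewrite pq eqxx ne /= /complement_rel ne clS.
Qed.

(** * The lower bound and the exact value *)

Lemma ramsey_lower (A : sgraph -> Prop) (G : sgraph) a b m : A G ->
    (forall S : {set G}, clique S -> #|S| < a) ->
    (forall S : {set G}, independent S -> #|S| < b) ->
  ramsey_bound A a b m -> #|G| < m.
Proof.
move=> AG ncl nind R; rewrite ltnNge; apply/negP=> mG.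
have [[S [cS /ncl]]|[S [cS /nind]]] := R G AG mG; by rewrite cS ltnn.
Qed.

Lemma complement_clique_independent (G : sgraph) (S : {set G}) :
  @clique (complement G) S -> independent S.
Proof.
move=> cl x y xS yS; have [->|xy] := eqVneq x y; first by rewrite adj_irrefl.
by have /andP[] := cl x y xS yS xy.
Qed.

Theorem theorem3 (a b : nat) (ha : 3 <= a) (hb : 3 <= b) :
  is_ramsey_number claw_coclaw_free a b
    (if (a == 4) && (b == 4) then 10
     else maxn ((5 * a - 3) %/ 2) ((5 * b - 3) %/ 2)).
Proof.
split.
  (* If [a] and [b] exceed 3 and are not both 4, one is at least 5 and the maximum is at least
     11. *)
  by case: ifP => [/andP[/eqP-> /eqP->]|ab4]; apply: ramsey_upper; lia.
move=> m R; case: ifP => [/andP[/eqP a4 /eqP b4]|_].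
  subst a b; have := ramsey_lower rook_free rook_clique rook_independent R.
  by rewrite card_prod !card_ord.
have cl N (S : {set pentagons N}) c : 3 <= c -> clique S -> #|S| < c.
  by move=> c3 /pentagons_clique/leq_trans; apply.
have ind c (S : {set pentagons ((5 * c - 5) %/ 2)}) :
    3 <= c -> independent S -> #|S| < c.
  by move=> c3 indS; apply: pentagons_independent => //; apply: ltn_trans c3.
rewrite geq_max; apply/andP; split.
  (* Complementing turns the bound on independent sets into one on cliques. The order is one less
     than [(5 * a - 3) %/ 2]. *)
  have := ramsey_lower (G := complement (pentagons ((5 * a - 5) %/ 2))) _ _ _ R.
  rewrite /= card_ord => H; suff: (5 * a - 5) %/ 2 < m by clear - ha; lia.
  apply: H => [|S|S]; first exact/claw_coclaw_free_complement/pentagons_free.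
    by move/complement_clique_independent; apply: ind.
  by move/complement_independent_clique; apply: cl.
have := ramsey_lower (G := pentagons ((5 * b - 5) %/ 2)) (pentagons_free _) _ _ R.
rewrite /= card_ord => H; suff: (5 * b - 5) %/ 2 < m by clear - hb; lia.
by apply: H => S; [apply: cl | apply: ind].
Qed.
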